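(* Let $(x,y,z)$ be a null triple in the imaginary split octonions $\mathbb{I}$, and put $w=2(x\times y)\times z$. Then the seven vectors $$x,\quad y,\quad z,\quad x\times y,\quad y\times z,\quad z\times x,\quad w$$ form a basis of $\mathbb{I}$. In this basis the dot and cross products are as follows. Arrange the six outer vectors cyclically in the order $$x\to x\times y\to y\to y\times z\to z\to z\times x\to x ,$$ as vertices of an oriented hexagon; thus adjacent vectors are consecutive in this cycle, and the opposite pairs are $\{x,y\times z\}$, $\{y,z\times x\}$, $\{z,x\times y\}$. Dot product (symmetric): all six outer vectors are null; opposite outer vectors have dot product $\tfrac12$; each outer vector is orthogonal to all outer vectors other than its opposite; $w$ is orthogonal to all six outer vectors; and $w\cdot w=-1$. Cross product (antisymmetric): the cross product of adjacent outer vectors is $0$; if $a\to b\to c$ are three consecutive outer vectors in the cycle then $a\times c=b$; for opposite outer vectors, $(x\times y)\times z=(y\times z)\times x=(z\times x)\times y=\tfrac12 w$; and $w\times x=x$, $w\times y=y$, $w\times z=z$, $(x\times y)\times w=x\times y$, $(y\times z)\times w=y\times z$, $(z\times x)\times w=z\times x$.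
   Context: $\mathbb{H}$ denotes the quaternions. The split octonions $\mathbb{O}'$ are the real vector space $\mathbb{H}\oplus\mathbb{H}$ with product $(a,b)(c,d)=(ac+d\overline{b},\,\overline{a}d+cb)$, conjugation $\overline{(a,b)}=(\overline{a},-b)$ and quadratic form $Q(a,b)=|a|^2-|b|^2$. The imaginary split octonions are $\mathbb{I}=\{x\in\mathbb{O}':\overline{x}=-x\}=\mathrm{Im}(\mathbb{H})\oplus\mathbb{H}$. The dot product is the symmetric bilinear form with $x\cdot x=Q(x)$; on $\mathbb{I}$, $x\cdot y=-\tfrac12(xy+yx)$ (real multiples of $1$ identified with reals). The cross product on $\mathbb{I}$ is $x\times y=\tfrac12(xy-yx)$. A vector $x$ is null if $x\cdot x=0$. A null triple is an ordered triple $(x,y,z)$ of nonzero null vectors in $\mathbb{I}$ that are pairwise orthogonal and satisfy $(x\times y)\cdot z=\tfrac12$. *)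

(* Defs.v *)
From HB Require Import structures.
From mathcomp Require Import all_boot all_order all_algebra.
From mathcomp Require Import reals.
From mathcomp Require Import ring lra.

Set Implicit Arguments.
Unset Strict Implicit.
Unset Printing Implicit Defensive.

Import GRing.Theory Num.Theory.

Local Open Scope ring_scope.

Record quat (R : realType) := Quat { qre : R; qi : R; qj : R; qk : R }.

Section Quaternions.

Variable R : realType.

Implicit Types (a b c : quat R) (t : R).

Definition quat_to_row a : 'rV[R]_4 :=
  \row_(i < 4) [:: qre a; qi a; qj a; qk a]`_i.

Definition quat_of_row (u : 'rV[R]_4) : quat R :=
  Quat (u 0 (inord 0)) (u 0 (inord 1)) (u 0 (inord 2)) (u 0 (inord 3)).

Lemma quat_to_rowK : cancel quat_to_row quat_of_row.
Proof. by case=> *; rewrite /quat_of_row !mxE !inordK. Qed.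

Lemma quat_of_rowK : cancel quat_of_row quat_to_row.
Proof.
move=> u; apply/rowP => i; rewrite !mxE /=.
by case: i => [] [|[|[|[|//]]]] lti /=; congr (u 0 _);
  apply: val_inj; rewrite /= inordK.
Qed.

HB.instance Definition _ := Choice.copy (quat R) (can_type quat_to_rowK).

Definition quat_zero : quat R := Quat 0 0 0 0.
Definition quat_opp a := Quat (- qre a) (- qi a) (- qj a) (- qk a).
Definition quat_add a b :=
  Quat (qre a + qre b) (qi a + qi b) (qj a + qj b) (qk a + qk b).
Definition quat_scale t a := Quat (t * qre a) (t * qi a) (t * qj a) (t * qk a).
Definition quat_one : quat R := Quat 1 0 0 0.
Definition quat_mul a b :=
  Quat (qre a * qre b - qi a * qi b - qj a * qj b - qk a * qk b)
       (qre a * qi b + qi a * qre b + qj a * qk b - qk a * qj b)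
       (qre a * qj b - qi a * qk b + qj a * qre b + qk a * qi b)
       (qre a * qk b + qi a * qj b - qj a * qi b + qk a * qre b).

Fact quat_addA : associative quat_add.
Proof. by move=> [? ? ? ?] [? ? ? ?] [? ? ? ?]; congr Quat => /=; ring. Qed.
Fact quat_addC : commutative quat_add.
Proof. by move=> [? ? ? ?] [? ? ? ?]; congr Quat => /=; ring. Qed.
Fact quat_add0 : left_id quat_zero quat_add.
Proof. by move=> [? ? ? ?]; congr Quat => /=; ring. Qed.
Fact quat_addN : left_inverse quat_zero quat_opp quat_add.
Proof. by move=> [? ? ? ?]; congr Quat => /=; ring. Qed.

HB.instance Definition _ :=
  GRing.isZmodule.Build (quat R) quat_addA quat_addC quat_add0 quat_addN.

Fact quat_mulA : associative quat_mul.
Proof. by move=> [? ? ? ?] [? ? ? ?] [? ? ? ?]; congr Quat => /=; ring. Qed.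
Fact quat_mul1l : left_id quat_one quat_mul.
Proof. by move=> [? ? ? ?]; congr Quat => /=; ring. Qed.
Fact quat_mul1r : right_id quat_one quat_mul.
Proof. by move=> [? ? ? ?]; congr Quat => /=; ring. Qed.
Fact quat_mulDl : left_distributive quat_mul +%R.
Proof. by move=> [? ? ? ?] [? ? ? ?] [? ? ? ?]; congr Quat => /=; ring. Qed.
Fact quat_mulDr : right_distributive quat_mul +%R.
Proof. by move=> [? ? ? ?] [? ? ? ?] [? ? ? ?]; congr Quat => /=; ring. Qed.
Fact quat_one_neq0 : quat_one != 0.
Proof. by apply/eqP => -[] /eqP; rewrite oner_eq0. Qed.

HB.instance Definition _ := GRing.Zmodule_isNzRing.Build (quat R)
  quat_mulA quat_mul1l quat_mul1r quat_mulDl quat_mulDr quat_one_neq0.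

Fact quat_scaleA s t a : quat_scale s (quat_scale t a) = quat_scale (s * t) a.
Proof. by case: a => *; congr Quat => /=; ring. Qed.
Fact quat_scale1 : left_id 1 quat_scale.
Proof. by move=> [? ? ? ?]; congr Quat => /=; ring. Qed.
Fact quat_scaleDr : right_distributive quat_scale +%R.
Proof. by move=> ? [? ? ? ?] [? ? ? ?]; congr Quat => /=; ring. Qed.
Fact quat_scaleDl a : {morph quat_scale^~ a : s t / s + t}.
Proof. by move=> ? ?; case: a => *; congr Quat => /=; ring. Qed.

HB.instance Definition _ := GRing.Zmodule_isLmodule.Build R (quat R)
  quat_scaleA quat_scale1 quat_scaleDr quat_scaleDl.

Fact quat_vect_iso : Vector.axiom 4 (quat R).
Proof.
exists quat_to_row; last by exists quat_of_row; [exact: quat_to_rowK | exact: quat_of_rowK].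
move=> t [? ? ? ?] [? ? ? ?]; apply/rowP => i; rewrite !mxE.
by case: i => [] [|[|[|[|//]]]].
Qed.

HB.instance Definition _ := Lmodule_hasFinDim.Build R (quat R) quat_vect_iso.

Definition qconj a : quat R := Quat (qre a) (- qi a) (- qj a) (- qk a).

Definition qnorm2 a : R := qre a ^+ 2 + qi a ^+ 2 + qj a ^+ 2 + qk a ^+ 2.

End Quaternions.

(* As a product type this also carries the library's componentwise ring
   multiplication; the split octonion product is [omul], never [*%R]. *)
Definition split_octonion (R : realType) : Type := (quat R * quat R)%type.

Section SplitOctonions.

Variable R : realType.

Implicit Types u v : split_octonion R.

Definition omul u v : split_octonion R :=
  (u.1 * v.1 + v.2 * qconj u.2, qconj u.1 * v.2 + v.1 * u.2).

Definition oconj u : split_octonion R := (qconj u.1, - u.2).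

Definition oQ u : R := qnorm2 u.1 - qnorm2 u.2.

(* The polar form of [oQ], normalised so that [odot u u = oQ u]. *)
Definition odot u v : R := (oQ (u + v) - oQ u - oQ v) / 2.

Definition ocross u v : split_octonion R := 2^-1 *: (omul u v - omul v u).

Definition oconj_add u : split_octonion R := oconj u + u.

Fact oconj_add_linear : linear oconj_add.
Proof.
move=> t [[? ? ? ?] [? ? ? ?]] [[? ? ? ?] [? ? ? ?]].
by congr pair; congr Quat => /=; ring.
Qed.

HB.instance Definition _ := GRing.isLinear.Build R (split_octonion R)
  (split_octonion R) *:%R oconj_add oconj_add_linear.

(* Encoded as a kernel to obtain a subspace; see [mem_imso]. *)
Definition imso : {vspace split_octonion R} := lker (linfun oconj_add).

Lemma mem_imso u : (u \in imso) = (oconj u == - u).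
Proof. by rewrite memv_ker lfunE /= addr_eq0. Qed.

Lemma odotuu u : odot u u = oQ u.
Proof.
case: u => [[? ? ? ?] [? ? ? ?]].
by rewrite /odot /oQ /qnorm2 /=; field.
Qed.

Lemma omul_sym_imso u v : u \in imso -> v \in imso ->
  - 2^-1 *: (omul u v + omul v u) = (odot u v *: (1 : quat R), 0 : quat R).
Proof.
have im_re (s : split_octonion R) : s \in imso -> qre s.1 = 0.
  rewrite mem_imso => /eqP/(congr1 (fun s : split_octonion R => qre s.1)) /=.
  by lra.
move=> /im_re u0 /im_re v0.
move: u v u0 v0 => [[? ? ? ?] [? ? ? ?]] [[? ? ? ?] [? ? ? ?]] /= -> ->.
by congr pair; congr Quat; rewrite /odot /oQ /qnorm2 /=; field.
Qed.

Lemma ocross_imso u v : u \in imso -> v \in imso -> ocross u v \in imso.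
Proof.
rewrite !mem_imso; move: u v => [[? ? ? ?] [? ? ? ?]] [[? ? ? ?] [? ? ? ?]].
by move=> _ _; apply/eqP; congr pair; congr Quat => /=; field.
Qed.

Lemma odot_linear u : linear (odot u : split_octonion R -> R^o).
Proof.
case: u => [[? ? ? ?] [? ? ? ?]].
move=> t [[? ? ? ?] [? ? ? ?]] [[? ? ? ?] [? ? ? ?]].
by rewrite /odot /oQ /qnorm2 /GRing.scale /=; field.
Qed.

Definition null_vector u : Prop := odot u u = 0.

Definition null_triple (x y z : split_octonion R) : Prop :=
  [/\ [/\ x \in imso, y \in imso & z \in imso],
      [/\ x != 0, y != 0 & z != 0],
      [/\ null_vector x, null_vector y & null_vector z],
      [/\ odot x y = 0, odot y z = 0 & odot z x = 0]
    & odot (ocross x y) z = 2^-1].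

(* The cyclic order of the outer vectors is addition of 1 in 'Z_6; opposite
   vertices differ by 3. *)
Definition hexagon (x y z : split_octonion R) (i : 'Z_6) : split_octonion R :=
  tnth [tuple x; ocross x y; y; ocross y z; z; ocross z x] i.

End SplitOctonions.

(* Main.v *)
From HB Require Import structures.
Require Import Defs.
From mathcomp Require Import all_boot all_order all_algebra.
From mathcomp Require Import reals.
From mathcomp Require Import ring lra zify.

(** Two identities of the imaginary split octonions carry everything. The
    triple product (u × v) . w is invariant under cyclic permutation
    ([odot_ocross_cyclic]), and the double cross product obeys
      u × (v × w) + v × (u × w) = (u.w) v + (v.w) u - 2 (u.v) w
    ([ocross_ocrossD]), whose diagonal case u = v is
      u × (u × w) = (u.w) u - (u.u) w
    ([ocross_ocross]). These are polynomial identities in the coordinates.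

    For a null triple nearly all terms on the right vanish, because x, y, z
    are null and orthogonal; the survivors come from the normalisation
    (x × y) . z = 1/2. For instance (x × y) × w = 2 (x × y) × ((x × y) × z)
    = x × y, since x × y is null and meets z in 1/2.

    The hypotheses are stable under (x, y, z) -> (y, z, x)
    ([null_triple_rot]). This turns the hexagon by two vertices and fixes the
    axis w ([axis_rot]), so a property of all vertices need be checked only at
    x and at x × y ([hexagon_rot_ind]).

    The products give the basis. Up to the factor 1/2, opposite vertices of
    the hexagon are dual for the dot product, so the six outer vectors are
    independent; w is orthogonal to them and w . w = -1, so it is not in their
    span. Finally the imaginary split octonions have dimension at most 7, as
    the kernel of a nonzero linear map on an 8-dimensional space. *)

Set Implicit Arguments.
Unset Strict Implicit.
Unset Printing Implicit Defensive.

Import GRing.Theory Num.Theory.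

Local Open Scope ring_scope.

(** * Dot and cross product identities *)

Section Identities.
Variable R : realType.
Implicit Types (t : R) (u v w x y z : split_octonion R).

Lemma odotC u v : odot u v = odot v u.
Proof. by rewrite /odot [u + v]addrC addrAC. Qed.

HB.instance Definition _ u :=
  GRing.isLinear.Build R (split_octonion R) R^o *:%R (odot u) (odot_linear u).

Lemma odot0r u : odot u 0 = 0. Proof. exact: linear0. Qed.
Lemma odotNr u v : odot u (- v) = - odot u v. Proof. exact: linearN. Qed.
Lemma odotZr t u v : odot u (t *: v) = t * odot u v. Proof. exact: linearZ. Qed.
Lemma odot0l u : odot 0 u = 0. Proof. by rewrite odotC odot0r. Qed.
Lemma odotNl u v : odot (- u) v = - odot u v.
Proof. by rewrite odotC odotNr odotC. Qed.
Lemma odotZl t u v : odot (t *: u) v = t * odot u v.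
Proof. by rewrite odotC odotZr odotC. Qed.

Lemma ocrossC u v : ocross u v = - ocross v u.
Proof. by rewrite /ocross -scalerN opprB. Qed.

Lemma ocrossuu u : ocross u u = 0.
Proof. by rewrite /ocross subrr scaler0. Qed.

Lemma ocrossZl t u v : ocross (t *: u) v = t *: ocross u v.
Proof.
move: u v => [[? ? ? ?] [? ? ? ?]] [[? ? ? ?] [? ? ? ?]].
by congr pair; congr Quat => /=; field.
Qed.

Lemma ocrossZr t u v : ocross u (t *: v) = t *: ocross u v.
Proof. by rewrite ocrossC ocrossZl -scalerN -ocrossC. Qed.

Lemma ocrossNr u v : ocross u (- v) = - ocross u v.
Proof. by rewrite -scaleN1r ocrossZr scaleN1r. Qed.

Lemma odot_ocross_cyclic u v w : odot (ocross u v) w = odot (ocross v w) u.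
Proof.
move: u v w => [[? ? ? ?] [? ? ? ?]] [[? ? ? ?] [? ? ? ?]] [[? ? ? ?] [? ? ? ?]].
by rewrite /odot /oQ /qnorm2 /=; field.
Qed.

Lemma imso_re0 u : u \in imso R -> qre u.1 = 0.
Proof.
rewrite mem_imso => /eqP/(congr1 (fun s : split_octonion R => qre s.1)) /=.
by lra.
Qed.

(** The polarised form of [ocross_ocross]; it comes from the alternativity
    of the octonion product. Real parts must vanish: the cross product ignores
    them while the right-hand side does not. *)
Lemma ocross_ocrossD u v w : u \in imso R -> v \in imso R -> w \in imso R ->
  ocross u (ocross v w) + ocross v (ocross u w) =
  odot u w *: v + odot v w *: u - (2 * odot u v) *: w.
Proof.
move=> /imso_re0 + /imso_re0 + /imso_re0.
move: u v w => [[? ? ? ?] [? ? ? ?]] [[? ? ? ?] [? ? ? ?]] [[? ? ? ?] [? ? ? ?]].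
move=> /= -> -> ->.
by congr pair; congr Quat; rewrite /odot /oQ /qnorm2 /=; field.
Qed.

Lemma ocross_ocross u v : u \in imso R -> v \in imso R ->
  ocross u (ocross u v) = odot u v *: u - odot u u *: v.
Proof.
move=> uI vI; have two_unit : (2 : R) != 0 by rewrite pnatr_eq0.
apply: (scalerI two_unit).
rewrite {1}scaler_nat [LHS]mulr2n ocross_ocrossD // -scalerDl scalerBr !scalerA.
by congr (_ *: u - _); ring.
Qed.

Lemma odot_ocross_self u v : odot (ocross u v) u = 0.
Proof. by rewrite -odot_ocross_cyclic ocrossuu odot0l. Qed.

Lemma odot_ocross_selfr u v : odot (ocross u v) v = 0.
Proof. by rewrite odot_ocross_cyclic ocrossuu odot0l. Qed.

Lemma ocross_isotropic u v : u \in imso R -> v \in imso R ->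
  null_vector u -> odot u v = 0 -> ocross u (ocross u v) = 0.
Proof.
by move=> uI vI; rewrite /null_vector ocross_ocross // => -> ->; rewrite !scale0r subr0.
Qed.

(** By cyclicity (u × v) . (u × v) = ((u × v) × u) . v, and
    (u × v) × u = - u × (u × v) = 0. *)
Lemma null_ocross u v : u \in imso R -> v \in imso R ->
  null_vector u -> odot u v = 0 -> null_vector (ocross u v).
Proof.
move=> uI vI u0 uv0; rewrite /null_vector odot_ocross_cyclic odot_ocross_cyclic.
by rewrite ocrossC ocross_isotropic // oppr0 odot0l.
Qed.

(** * Null triples and their axis *)

Lemma null_triple_rot x y z : null_triple x y z -> null_triple y z x.
Proof.
case=> -[xI yI zI] [x0 y0 z0] [xn yn zn] [xy yz zx] vol.
by split=> //; rewrite -odot_ocross_cyclic.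
Qed.

(** The polarised double cross product of z, x and y has zero right-hand side,
    because the three vectors are pairwise orthogonal. *)
Lemma null_triple_axis_rot x y z : null_triple x y z ->
  ocross (ocross x y) z = ocross (ocross y z) x.
Proof.
case=> -[xI yI zI] _ _ [xy yz zx] _.
have := ocross_ocrossD zI xI yI.
rewrite zx xy (odotC z) yz mulr0 !scale0r addr0 subr0 => /eqP.
rewrite addr_eq0 (ocrossC z y) ocrossNr opprK => /eqP E.
by rewrite ocrossC E -ocrossC.
Qed.

Definition axis x y z := 2 *: ocross (ocross x y) z.

Lemma axis_rot x y z : null_triple x y z -> axis y z x = axis x y z.
Proof. by move=> T; rewrite /axis (null_triple_axis_rot T). Qed.

(** Here w × z = 2 z × (z × (x × y)), and z is null with z . (x × y) = 1/2. *)
Lemma ocross_axis x y z : null_triple x y z -> ocross (axis x y z) z = z.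
Proof.
case=> -[xI yI zI] _ [_ _ zn] _ vol.
rewrite /axis ocrossZl ocrossC (ocrossC _ z) ocrossNr opprK.
rewrite ocross_ocross ?ocross_imso // odotC vol zn scale0r subr0 scalerA.
by rewrite mulfV ?scale1r // pnatr_eq0.
Qed.

Lemma ocross_edge_axis x y z : null_triple x y z ->
  ocross (ocross x y) (axis x y z) = ocross x y.
Proof.
case=> -[xI yI zI] _ [xn yn zn] [xy _ _] vol.
rewrite /axis ocrossZr ocross_ocross ?ocross_imso // vol.
rewrite (null_ocross xI yI xn xy) scale0r subr0 scalerA.
by rewrite mulfV ?scale1r // pnatr_eq0.
Qed.

Lemma odot_axis_vertex x y z : odot (axis x y z) z = 0.
Proof. by rewrite odotZl odot_ocross_selfr mulr0. Qed.

Lemma odot_axis_edge x y z : odot (axis x y z) (ocross x y) = 0.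
Proof. by rewrite odotZl odot_ocross_self mulr0. Qed.

(** By cyclicity w . w = 2 (w × (x × y)) . z = - 2 (x × y) . z. *)
Lemma odot_axis x y z : null_triple x y z -> odot (axis x y z) (axis x y z) = -1.
Proof.
move=> T; have [[xI yI zI] _ _ _ vol] := T.
rewrite {2}/axis odotZr odotC odot_ocross_cyclic odot_ocross_cyclic.
by rewrite ocrossC ocross_edge_axis // odotNl vol; field.
Qed.

(** * Products of hexagon vertices *)

Lemma hexagon_rot x y z i : hexagon y z x i = hexagon x y z (i + 2).
Proof. by case: i => [[|[|[|[|[|[|//]]]]]] lti]. Qed.

(** Turning by two vertices is the cyclic permutation of the triple, so the
    six vertices fall into the two orbits of 0 and 1. The relation [P] takes
    three vertices at fixed offsets, enough for the rule a × c = b on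
    consecutive vertices; binary relations ignore the last argument. *)
Lemma hexagon_rot_ind (P : split_octonion R -> split_octonion R ->
    split_octonion R -> Prop) (j k : 'Z_6) :
  (forall x y z, null_triple x y z -> let h := hexagon x y z in
     P (h 0) (h j) (h k) /\ P (h 1) (h (1 + j)) (h (1 + k))) ->
  forall x y z, null_triple x y z -> let h := hexagon x y z in
  forall i, P (h i) (h (i + j)) (h (i + k)).
Proof.
move=> base.
have rot x y z i : let h := hexagon y z x in P (h i) (h (i + j)) (h (i + k)) ->
    let h := hexagon x y z in P (h (i + 2)) (h (i + 2 + j)) (h (i + 2 + k)).
  by rewrite /= !(hexagon_rot x y z) ![i + _ + 2]addrAC.
have base' x y z (T : null_triple x y z) : let h := hexagon x y z in
    P (h 0) (h (0 + j)) (h (0 + k)) /\ P (h 1) (h (1 + j)) (h (1 + k)).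
  by rewrite /= !add0r; apply: base.
move=> x y z T h i; rewrite {}/h.
have T' := null_triple_rot T; have T'' := null_triple_rot T'.
have [P0 P1] := base' _ _ _ T.
have [/rot P2 /rot P3] := base' _ _ _ T'.
have [/rot/rot P4 /rot/rot P5] := base' _ _ _ T''.
by case: i => [[|[|[|[|[|[|//]]]]]] lti];
  [move: P0|move: P1|move: P2|move: P3|move: P4|move: P5];
  congr (P _ _ _); congr (hexagon x y z _); apply: val_inj.
Qed.

Lemma odot_edges x y z : null_triple x y z -> odot (ocross x y) (ocross y z) = 0.
Proof.
case=> -[xI yI zI] _ [_ yn _] [_ yz _] _.
by rewrite odot_ocross_cyclic ocross_isotropic // odot0l.
Qed.

Lemma axis_half x y z : ocross (ocross x y) z = 2^-1 *: axis x y z.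
Proof. by rewrite scalerA mulVf ?scale1r // pnatr_eq0. Qed.

(** Polarise with u = x × y and v = y: the right-hand side is y / 2, and the
    second term on the left is y × (w / 2) = - y / 2. *)
Lemma ocross_edges x y z : null_triple x y z ->
  ocross (ocross x y) (ocross y z) = y.
Proof.
move=> T; have [[xI yI zI] _ [_ yn _] [_ yz _] vol] := T.
have axis_y : ocross (axis x y z) y = y.
  by rewrite -(axis_rot T) -(axis_rot (null_triple_rot T)) ocross_axis //;
     do 2 apply: null_triple_rot.
have := ocross_ocrossD (ocross_imso xI yI) yI zI.
rewrite vol yz odot_ocross_selfr mulr0 !scale0r addr0 subr0 (axis_half x y z).
rewrite (ocrossZr _ y (axis x y z)) (ocrossC y (axis _ _ _)) axis_y scalerN => /eqP.
rewrite subr_eq -scalerDl => /eqP ->.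
by rewrite -[RHS]scale1r; congr (_ *: y); field.
Qed.

Lemma hexagonE x y z i :
  hexagon x y z i =
    nth 0 [:: x; ocross x y; y; ocross y z; z; ocross z x] i.
Proof. exact: tnth_nth. Qed.

(** Offset [k = 0] is included: it says that the vertices are null. *)
Lemma odot_hexagon_near (k : 'Z_6) : k != 3 ->
  forall x y z, null_triple x y z -> forall i,
  odot (hexagon x y z i) (hexagon x y z (i + k)) = 0.
Proof.
move=> k3 x y z T.
apply: (@hexagon_rot_ind (fun u v _ => odot u v = 0) k 0) T => {}x {}y {}z T.
have [[xI yI zI] _ [xn yn zn] [xy yz zx] vol] := T.
have T' := null_triple_rot T; have T'' := null_triple_rot T'.
(* For each [k] there are two goals, with first factor [x] and [ocross x y];
   the hypotheses of the triple close those for x . x and x . y. *)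
case: k k3 => [[|[|[|[|[|[|//]]]]]] ltk] //= _; rewrite !hexagonE /=; split=> //.
- exact: null_ocross.
- by rewrite odotC odot_ocross_self.
- exact: odot_ocross_selfr.
- exact: odot_edges.
- by rewrite odotC.
- by rewrite odotC odot_edges.
- by rewrite odotC odot_ocross_selfr.
- exact: odot_ocross_self.
Qed.

Lemma hexagon_ocross_next x y z : null_triple x y z -> forall i,
  ocross (hexagon x y z i) (hexagon x y z (i + 1)) = 0.
Proof.
move=> T.
apply: (@hexagon_rot_ind (fun u v _ => ocross u v = 0) 1 0) T => {}x {}y {}z T.
have [[xI yI zI] _ [xn yn zn] [xy yz zx] vol] := T.
rewrite /= !hexagonE /=; split; first exact: ocross_isotropic.
by rewrite ocrossC (ocrossC x) ocrossNr opprK ocross_isotropic // odotC.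
Qed.

Lemma hexagon_ocross_next2 x y z : null_triple x y z -> forall i,
  ocross (hexagon x y z i) (hexagon x y z (i + 2)) = hexagon x y z (i + 1).
Proof.
move=> T.
apply: (@hexagon_rot_ind (fun u v w => ocross u v = w) 2 1) T => {}x {}y {}z T.
by rewrite /= !hexagonE /= ocross_edges.
Qed.

Lemma hexagon_opposite x y z : null_triple x y z -> forall i,
  odot (hexagon x y z i) (hexagon x y z (i + 3)) = 2^-1.
Proof.
move=> T.
apply: (@hexagon_rot_ind (fun u v _ => odot u v = 2^-1) 3 0) T => {}x {}y {}z T.
have [_ _ _ _ vol] := T.
by rewrite /= !hexagonE /= odotC -odot_ocross_cyclic.
Qed.

Lemma odot_axis_hexagon x y z : null_triple x y z -> forall i,
  odot (axis x y z) (hexagon x y z i) = 0.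
Proof.
move=> T; have T' := null_triple_rot T; have T'' := null_triple_rot T'.
case=> [[|[|[|[|[|[|//]]]]]] lti]; rewrite hexagonE /=.
- by rewrite -(axis_rot T) odot_axis_vertex.
- by rewrite odot_axis_edge.
- by rewrite -(axis_rot T) -(axis_rot T') odot_axis_vertex.
- by rewrite -(axis_rot T) odot_axis_edge.
- by rewrite odot_axis_vertex.
- by rewrite -(axis_rot T) -(axis_rot T') odot_axis_edge.
Qed.
End Identities.

(** * The basis *)

Lemma free_of_dual (K : fieldType) (V : vectType K) n (X : n.-tuple V)
    (f : 'I_n -> {linear V -> K^o}) :
  (forall i, f i X`_i != 0) ->
  (forall i j : 'I_n, j != i -> f i X`_j = 0) -> free X.
Proof.
move=> f_diag f_off; apply/freeP => k /[swap] i /(congr1 (f i)).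
rewrite linear0 linear_sum (bigD1 i) //= big1 => [|j ji]; last first.
  by rewrite linearZ /= f_off // scaler0.
by rewrite addr0 linearZ => /eqP; rewrite mulf_eq0 (negPf (f_diag i)) orbF => /eqP.
Qed.

(** Equality holds, but this bound suffices: seven independent vectors of
    [imso R] then span it. *)
Lemma dim_imso_le (R : realType) : (\dim (imso R) <= 7)%N.
Proof.
pose f : 'End(split_octonion R) := linfun (@oconj_add R).
have dimO : \dim {:split_octonion R} = 8%N by rewrite dimvf.
have img_gt0 : (0 < \dim (limg f))%N.
  rewrite lt0n dimv_eq0; apply/eqP => f0.
  (* The unit (1, 0) is sent to (2, 0). *)
  have : f (1, 0) \in limg f by exact: memv_img (memvf _).
  rewrite f0 memv0 lfunE => /eqP/(congr1 (fun u : split_octonion R => qre u.1)) /=.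
  by lra.
have := limg_ker_dim f fullv; rewrite capfv dimO => dim_split.
move: dim_split; case: (\dim (limg f)) img_gt0 => // n _; rewrite addnS => -[<-].
exact: leq_addr.
Qed.

(** The dual family consists of the dot products with the opposite vertices. *)
Lemma free_hexagon (R : realType) (x y z : split_octonion R) :
  null_triple x y z ->
  free [:: x; ocross x y; y; ocross y z; z; ocross z x].
Proof.
move=> T; pose h := hexagon x y z.
apply: (free_of_dual (X := [tuple x; ocross x y; y; ocross y z; z; ocross z x])
  (f := fun i : 'Z_6 => odot (h (i + 3)))) => [i | i j ji].
  by rewrite -(hexagonE x y z i) /= odotC hexagon_opposite // invr_eq0 pnatr_eq0.
rewrite -(hexagonE x y z j) /= -[j in hexagon _ _ _ j](subrK (i + 3)).
rewrite (addrC (j - _)) /h.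
rewrite odot_hexagon_near // subr_eq [3 + _]addrC -addrA.
by rewrite (_ : 3 + 3 = 0) ?addr0 //; apply: val_inj.
Qed.

Lemma null_triple_basis (R : realType) (x y z : split_octonion R) :
  null_triple x y z ->
  basis_of (imso R)
    [:: x; y; z; ocross x y; ocross y z; ocross z x; axis x y z].
Proof.
move=> T; set X := [:: _; _; _; _; _; _; _].
have XE : perm_eq X (axis x y z :: [:: x; ocross x y; y; ocross y z; z; ocross z x]).
  by apply/permP => p /=; lia.
have freeX : free X.
  rewrite (perm_free XE) free_cons (free_hexagon T) andbT; apply/negP => w_span.
  (* [odot w] vanishes on the span of the hexagon but not at [w]. *)
  have /subvP/(_ _ w_span) : (<<[:: x; ocross x y; y; ocross y z; z; ocross z x]>>
      <= lker (linfun (odot (axis x y z) : split_octonion R -> R^o)))%VS.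
    apply/span_subvP => u /(nthP 0)[i lti <-].
    by rewrite memv_ker lfunE -(hexagonE x y z (Ordinal lti)) /= odot_axis_hexagon.
  by rewrite memv_ker lfunE /= odot_axis // oppr_eq0 oner_eq0.
rewrite basisEfree freeX dim_imso_le andbT.
have [[xI yI zI] _ _ _ _] := T.
apply/span_subvP/allP; rewrite /= xI yI zI !ocross_imso //=.
by rewrite memvZ // !ocross_imso.
Qed.

Theorem theorem12 (R : realType) (x y z : split_octonion R)
    (Hxyz : null_triple x y z) :
  let w := 2 *: ocross (ocross x y) z in
  let h := hexagon x y z in
  [/\ basis_of (imso R)
        [:: x; y; z; ocross x y; ocross y z; ocross z x; w],
      [/\ forall u v : split_octonion R, u \in imso R -> v \in imso R -> odot u v = odot v u,
          forall i : 'Z_6, null_vector (h i),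
          forall i : 'Z_6, odot (h i) (h (i + 3)) = 2^-1,
          forall i j : 'Z_6, j != i + 3 -> odot (h i) (h j) = 0
        & (forall i : 'Z_6, odot w (h i) = 0) /\ odot w w = -1]
    & [/\ forall u v : split_octonion R, u \in imso R -> v \in imso R ->
            ocross u v = - ocross v u,
          forall i : 'Z_6, ocross (h i) (h (i + 1)) = 0,
          forall i : 'Z_6, ocross (h i) (h (i + 2)) = h (i + 1),
          [/\ ocross (ocross x y) z = 2^-1 *: w,
              ocross (ocross y z) x = 2^-1 *: w
            & ocross (ocross z x) y = 2^-1 *: w]
        & [/\ ocross w x = x, ocross w y = y & ocross w z = z] /\
          [/\ ocross (ocross x y) w = ocross x y,
              ocross (ocross y z) w = ocross y z
            & ocross (ocross z x) w = ocross z x]]].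
Proof.
have T' := null_triple_rot Hxyz; have T'' := null_triple_rot T'.
move=> w h; split; first exact: null_triple_basis.
  split=> [u v _ _ | i | i | i j ji |].
  - exact: odotC.
  - by have := odot_hexagon_near (isT : (0 : 'Z_6) != 3) Hxyz i; rewrite addr0.
  - exact: hexagon_opposite.
  - by rewrite /h -[j](subrK i) addrC odot_hexagon_near // subr_eq addrC.
  - by split; [exact: odot_axis_hexagon | exact: odot_axis].
have wE : w = axis x y z by [].
split=> [u v _ _ | i | i | |].
- exact: ocrossC.
- exact: hexagon_ocross_next.
- exact: hexagon_ocross_next2.
- by rewrite !axis_half (axis_rot T') (axis_rot Hxyz).
- rewrite wE; split; split.
  + by rewrite -(axis_rot Hxyz) ocross_axis.
  + by rewrite -(axis_rot Hxyz) -(axis_rot T') ocross_axis.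
  + exact: ocross_axis.
  + exact: ocross_edge_axis.
  + by rewrite -(axis_rot Hxyz) ocross_edge_axis.
  + by rewrite -(axis_rot Hxyz) -(axis_rot T') ocross_edge_axis.
Qed.
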